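(* Let $\lambda=(\lambda_1,\dots,\lambda_n)$ be an integer partition, $\lambda_1\ge\cdots\ge\lambda_n\ge 0$, and set $\lambda_{n+1}=0$. Let $$\Omega_n(\lambda)=\prod_{i=1}^n\left(x_1+x_2+\cdots+x_{\lambda_i}\right)$$ and let $N(\Omega_n(\lambda))$ be the number of distinct monomials in this product. (a) We have $$N(\Omega_n(\lambda))=\sum_{(k_1,\dots,k_n)\in K_n}\ \prod_{i=1}^n\left(\!\!\binom{\lambda_i-\lambda_{i+1}}{k_i}\!\!\right),$$ where $K_n=\{(k_1,\dots,k_n)\in\mathbb{N}^n:\ k_1+\cdots+k_i\le i\text{ for }1\le i\le n,\ \sum_{j=1}^n k_j=n\}$. (b) For $1\le i\le n$ such that $(\lambda_1,\dots,\lambda_{i-1},\lambda_i+1,\lambda_{i+1},\dots,\lambda_n)$ is again a partition, $$N(\Omega_n(\lambda_1,\dots,\lambda_{i-1},\lambda_i+1,\lambda_{i+1},\dots,\lambda_n))=N(\Omega_n(\lambda_1,\dots,\lambda_n))+N(\Omega_i(\lambda_1-\lambda_i,\dots,\lambda_{i-1}-\lambda_i,1))\cdot N(\Omega_{n-i}(\lambda_{i+1},\dots,\lambda_n)).$$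
   Context: $\mathbb{N}=\{0,1,2,\dots\}$. The products are polynomials with integer coefficients; the number of distinct monomials is the number of nonzero coefficients. An empty sum $x_1+\cdots+x_0$ is $0$ (so the product is then $0$ and has no monomials), and the empty product is $\Omega_0=1$, with $N(\Omega_0)=1$. The symbol $\left(\!\binom{r}{s}\!\right)=\binom{r+s-1}{s}$ is the number of $s$-combinations of an $r$-element set allowing repetition; in particular $\left(\!\binom{0}{0}\!\right)=1$ and $\left(\!\binom{0}{s}\!\right)=0$ for $s\ge 1$. *)

(* Defs.v *)
From mathcomp Require Import all_boot all_order all_algebra.
From mathcomp Require Import mpoly.

Set Implicit Arguments.
Unset Strict Implicit.
Unset Printing Implicit Defensive.

(** A partition [lambda_1 >= ... >= lambda_n >= 0] is a [sorted geq] list of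
    naturals, with [lambda_i] at position [i - 1]: trailing zeros are allowed,
    and the default value of [nth 0] gives [lambda_(n+1) = 0]. *)

(** [x_1, ..., x_m] are ['X_j] for [j : 'I_m]. For [m] at least as large as
    every part, the [j < l] are the [l] indices of [x_1, ..., x_l]; a smaller
    [m] would truncate the sums. *)
Definition Omega (m : nat) (lam : seq nat) : {mpoly int[m]} :=
  (\prod_(l <- lam) \sum_(j < m | (j < l)%N) 'X_j)%R.

(** All the variables that occur have index at most the largest part, so we
    count in the polynomial ring on exactly those variables. [msupp p] is the
    duplicate-free list of the monomials with nonzero coefficient in [p]. *)
Definition N (lam : seq nat) : nat :=
  size (msupp (Omega (\max_(l <- lam) l) lam)).

(** For [r = s = 0] the truncated predecessor makes this ['C(0, 0) = 1]. *)
Definition multichoose (r s : nat) : nat := 'C((r + s).-1, s).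

(** [k i] is [k_(i+1)], so the [i]-th condition reads
    [k_1 + ... + k_(i+1) <= i + 1]. *)
Definition inK (n : nat) (k : 'I_n -> nat) : bool :=
  [forall i : 'I_n, \sum_(j < n | j <= i) k j <= i.+1]
  && (\sum_(j < n) k j == n).

(** Since the entries of an element of [K_n] sum to [n], they all lie in
    ['I_n.+1]; this makes [K_n] a subset of a finite type. *)
Lemma inK_bound (n : nat) (k : 'I_n -> nat) (i : 'I_n) : inK k -> k i < n.+1.
Proof.
case/andP=> _ /eqP sum_k.
by rewrite ltnS -[leqRHS]sum_k (bigD1 i) //= leq_addr.
Qed.

Definition K (n : nat) : {set {ffun 'I_n -> 'I_n.+1}} :=
  [set k : {ffun 'I_n -> 'I_n.+1} | inK (fun i => k i)].

(* Main.v *)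
(** Sorting the variables of a monomial of [Omega lam] decreasingly turns it
    into a weakly decreasing sequence [mu] with [1 <= mu_i <= lam_i], and every
    such [mu] occurs; there is no cancellation, so [N lam] counts these [mu].
    Raising [lam_i] by one adds the [mu] with [mu_i = lam_i + 1]; such a [mu]
    splits at [i] into two independent pieces, which gives (b).
    For (a), let [k_i] be the number of entries of [mu] with
    [lam_(i+1) < mu_j <= lam_i]: these form a multiset of size [k_i] over
    [lam_i - lam_(i+1)] values, and [mu_i <= lam_i] says that at most [i]
    entries of [mu] exceed [lam_(i+1)]. *)

Require Import Defs.
From mathcomp Require Import all_boot all_order all_algebra.
From mathcomp Require Import mpoly.
From mathcomp Require Import zify.

Set Implicit Arguments.
Unset Strict Implicit.
Unset Printing Implicit Defensive.

(** * Counting dominated weakly decreasing sequences *)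

(* Variables are indexed from 0, so that domination is the strict
   [mu_i < lam_i]; [c] is a strict upper bound on all entries. *)
Fixpoint domseqs (c : nat) (lam : seq nat) : seq (seq nat) :=
  if lam is l :: lam' then
    [seq v :: mu | v <- iota 0 (minn c l), mu <- domseqs v.+1 lam']
  else [:: [::]].

Definition ndom (c : nat) (lam : seq nat) : nat := size (domseqs c lam).

Lemma ndom_cons c l lam :
  ndom c (l :: lam) = \sum_(0 <= v < minn c l) ndom v.+1 lam.
Proof.
by rewrite /ndom /= size_allpairs_dep sumnE big_map /index_iota subn0.
Qed.

(** All entries are below [c], so a bound [l] acts only through [minn c l]. *)
Lemma eq_ndom c c' lam mu :
  map (minn c) lam = map (minn c') mu -> ndom c lam = ndom c' mu.
Proof.
elim: lam mu c c' => [|l lam IH] [|l' mu] c c' //= [eqll' eqlm].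
rewrite !ndom_cons -eqll'; apply: eq_big_nat => v /andP[_ lt_v].
apply: IH; have /(congr1 (map (minn v.+1))) := eqlm.
by rewrite -!map_comp !(eq_map (_ : _ =1 minn v.+1)) // => x /=; lia.
Qed.

(* The new sequences have the entry [x] where the bound was raised, so that all
   entries before it lie in [x, c). *)
Lemma ndom_incr c x lam1 lam2 : all (fun l => x < l) lam1 ->
  ndom c (lam1 ++ x.+1 :: lam2) =
    ndom c (lam1 ++ x :: lam2)
    + ndom (c - x) (rcons [seq l - x | l <- lam1] 1) * ndom x.+1 lam2.
Proof.
elim: lam1 c => [|l lam1 IH] c /=.
  move=> _; rewrite !ndom_cons; have [le_cx|lt_xc] := leqP c x.
    have -> : minn c x.+1 = c by lia.
    have -> : minn (c - x) 1 = 0 by lia.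
    by rewrite [X in _ = _ + X * _]big_geq ?mul0n ?addn0.
  have -> : minn c x.+1 = x.+1 by lia.
  have -> : minn (c - x) 1 = 1 by lia.
  by rewrite big_nat_recr //= big_nat1 mul1n.
case/andP=> lt_xl lt_xlam1; rewrite !ndom_cons.
have -> : minn (c - x) (l - x) = minn c l - x by lia.
rewrite (eq_bigr _ (fun v _ => IH v.+1 lt_xlam1)) big_split -big_distrl /=.
congr (_ + _ * _); set m := minn c l.
pose F v := ndom (v.+1 - x) (rcons [seq l' - x | l' <- lam1] 1).
rewrite -[LHS]/(\sum_(0 <= v < m) F v).
(* For [v < x] the bound [v.+1 - x] is [0], and the [rcons] list is never empty, so no sequence
   exists. *)
have F0 v : v < x -> F v = 0.
  rewrite /F -subn_eq0 => /eqP ->.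
  by case: (lam1) => [|? ?]; rewrite /= ndom_cons min0n big_geq.
have [le_mx|/ltnW le_xm] := leqP m x.
  rewrite [RHS]big_geq ?big1_seq //; last by lia.
  move=> v; rewrite mem_index_iota => /andP[_ /andP[_ lt_vm]].
  by apply: F0; lia.
rewrite (big_cat_nat (n := x)) //= big1_seq ?add0n; last first.
  by move=> v; rewrite mem_index_iota => /andP[_ /andP[_ /F0]].
rewrite -{1}[x]add0n big_addn; apply: eq_bigr => v _.
by rewrite /F -addSn addnK.
Qed.

(** * Multisets of large entries, for (a) *)

(** Split on the first entry: if it is [a], it is dropped and the bounds stay; if it is smaller, all
    entries are below [a] and every bound [a.+1] may be lowered to [a]. *)
Lemma ndom_nseqS p a lam : all (fun l => l <= a) lam ->
  ndom a.+1 (nseq p.+1 a.+1 ++ lam) =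
    ndom a (nseq p.+1 a ++ lam) + ndom a.+1 (nseq p a.+1 ++ lam).
Proof.
move=> le_lam; rewrite /= !ndom_cons !minnn big_nat_recr //=; congr (_ + _).
apply: eq_big_nat => v /andP[_ lt_va]; apply: eq_ndom.
by rewrite !map_cat !map_nseq (minn_idPl _) ?(minn_idPl _) // ltnW.
Qed.

Lemma multichoose_n0 r : multichoose r 0 = 1.
Proof. by rewrite /multichoose bin0. Qed.

Lemma multichoose_0S s : multichoose 0 s.+1 = 0.
Proof. by rewrite /multichoose add0n bin_small. Qed.

Lemma multichooseS r s :
  multichoose r.+1 s.+1 = multichoose r s.+1 + multichoose r.+1 s.
Proof. by rewrite /multichoose !addSn !addnS /= binS. Qed.

(** The index [k] counts the entries in [[a, a + d)]. They come first and form a multiset over [d]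
    values; the other entries lie below [a]. The double induction matches [ndom_nseqS] with the
    Pascal rule [multichooseS]. *)
Lemma ndom_nseq p a d lam : all (fun l => l <= a) lam ->
  ndom (a + d) (nseq p (a + d) ++ lam) =
    \sum_(k < p.+1) multichoose d k * ndom a (nseq (p - k) a ++ lam).
Proof.
move=> le_lam; elim: d p => [|d IHd] p.
  rewrite addn0 big_ord_recl multichoose_n0 mul1n subn0 big1 ?addn0 // => k _.
  by rewrite lift0 multichoose_0S.
elim: p => [|p IHp].
  rewrite big_ord1 multichoose_n0 mul1n /=; apply: eq_ndom.
  by apply/eq_in_map => l /(allP le_lam); lia.
rewrite addnS in IHp *; rewrite ndom_nseqS; last first.
  by apply: sub_all le_lam => l; lia.
rewrite IHp IHd big_ord_recl [RHS]big_ord_recl !multichoose_n0 -addnA.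
congr (_ + _); rewrite -big_split; apply: eq_bigr => k _ /=.
by rewrite /bump /= add1n subSS multichooseS mulnDl.
Qed.

(** * Summing over [K_n] one coordinate at a time *)

Definition fcons n (T : finType) (x : T) (f : {ffun 'I_n -> T}) :
    {ffun 'I_n.+1 -> T} :=
  [ffun i => oapp f x (unlift ord0 i)].

Lemma fcons0 n (T : finType) (x : T) (f : {ffun 'I_n -> T}) :
  fcons x f ord0 = x.
Proof. by rewrite ffunE unlift_none. Qed.

Lemma fconsS n (T : finType) (x : T) (f : {ffun 'I_n -> T}) i :
  fcons x f (lift ord0 i) = f i.
Proof. by rewrite ffunE liftK. Qed.

Lemma big_fcons n (T : finType) (P : pred {ffun 'I_n.+1 -> T})
    (F : {ffun 'I_n.+1 -> T} -> nat) :
  \sum_(f | P f) F f = \sum_x \sum_(f | P (fcons x f)) F (fcons x f).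
Proof.
rewrite pair_big_dep /=.
rewrite (reindex_onto (fun p => fcons p.1 p.2)
  (fun f => (f ord0, [ffun i => f (lift ord0 i)]))) /=; last first.
  move=> f _; apply/ffunP => i.
  by case: (unliftP ord0 i) => [j|] ->; rewrite ?fconsS ?fcons0 ?ffunE.
apply: eq_bigl => -[x f] /=; rewrite fcons0.
rewrite (_ : [ffun i => _] = f) ?eqxx ?andbT //.
by apply/ffunP => i; rewrite ffunE fconsS.
Qed.

(* [s] is the slack [i - (k_1 + ... + k_i)] left by the entries already peeled
   off; [inK_slack 0] is convertible to [inK]. *)
Definition inK_slack s n (k : 'I_n -> nat) : bool :=
  [forall i : 'I_n, \sum_(j < n | j <= i) k j <= s + i.+1]
  && (\sum_(j < n) k j == s + n).

(** Each index adds one to the slack and its entry [x] uses up [x]; the test [x < s.+2] keeps the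
    truncated [s.+1 - x] exact. *)
Lemma inK_slack_fcons s n (T : nat) (x : 'I_T) (k : {ffun 'I_n -> 'I_T}) :
  inK_slack s (fun i => fcons x k i) =
    (x < s.+2) && inK_slack (s.+1 - x) (fun i => k i).
Proof.
have sum_le (i : 'I_n) : \sum_(j < n.+1 | j <= lift ord0 i) fcons x k j
     = x + \sum_(j < n | j <= i) k j.
  rewrite big_mkcond big_ord_recl /= fcons0 [in RHS]big_mkcond.
  by congr (_ + _); apply: eq_bigr => j _; rewrite fconsS.
have sum_le0 : \sum_(j < n.+1 | j <= @ord0 n) fcons x k j = x :> nat.
  by rewrite big_mkcond big_ord_recl /= fcons0 big1 ?addn0.
have sum_all : \sum_(j < n.+1) fcons x k j = x + \sum_(j < n) k j.
  by rewrite big_ord_recl fcons0; congr (_ + _); apply: eq_bigr => j _;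
    rewrite fconsS.
rewrite /inK_slack sum_all; apply/andP/idP => [[/forallP le_k /eqP sum_k]|].
  have := le_k ord0; rewrite sum_le0 /= => lt_x; apply/and3P; split=> /=;
    [lia| | by rewrite -(eqn_add2l x) sum_k; lia].
  apply/forallP => i; rewrite -(leq_add2l x) -sum_le.
  by apply: leq_trans (le_k (lift ord0 i)) _; rewrite lift0; lia.
case/and3P=> lt_x /forallP le_k /eqP sum_k; split; last by rewrite sum_k; lia.
apply/forallP => i; case: (unliftP ord0 i) => [j|] ->; last first.
  by rewrite sum_le0 /=; lia.
by rewrite sum_le lift0; apply: leq_trans (leq_add (leqnn x) (le_k j)) _; lia.
Qed.

(** The [s] extra bounds stand for entries at earlier positions that fell below the current largest
    part. Peeling off that part makes [s.+1] entries available, of which [k] exceed the next part.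
    The codomain ['I_B] is kept apart from [size lam] so that it stays fixed in the induction. *)
Lemma ndom_multichoose B s lam : sorted geq lam -> s + size lam < B ->
  ndom (nth 0 lam 0) (nseq s (nth 0 lam 0) ++ lam) =
    \sum_(k : {ffun 'I_(size lam) -> 'I_B} | inK_slack s (fun i => k i))
      \prod_(i < size lam) multichoose (nth 0 lam i - nth 0 lam i.+1) (k i).
Proof.
elim: lam s => [|l lam IH] s lam_sorted ltB.
  rewrite /= cats0 /inK_slack.
  under eq_bigr do rewrite big_ord0.
  under eq_bigl => k do rewrite big_ord0 addn0.
  (* The default [nth 0 [::] 0 = 0] leaves pending entries no value, while an empty sum cannot equal
     [s.+1]: both sides vanish. *)
  case: s ltB => [|s] _; last first.
    by rewrite ndom_cons big_geq // big_pred0 // => k; rewrite andbF.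
  rewrite (eq_bigl xpredT) ?sum_nat_const ?card_ffun ?card_ord // => k.
  by rewrite andbT; apply/forallP => -[].
rewrite big_fcons /=.
have le_lam : all (fun l' => l' <= nth 0 lam 0) lam.
  have := path_sorted lam_sorted; case: (lam) => //= a lam'.
  rewrite path_sortedE; last by move=> x y z /=; lia.
  by rewrite leqnn => /andP[].
have le_l : nth 0 lam 0 <= l by case: (lam) lam_sorted => //= a ? /andP[].
have -> : nseq s l ++ l :: lam = nseq s.+1 l ++ lam.
  by rewrite -cat1s catA -(nseqD s 1) addn1.
rewrite -{1 2}(subnKC le_l) ndom_nseq //.
rewrite (big_ord_widen B (fun k => multichoose (l - nth 0 lam 0) k *
  ndom (nth 0 lam 0) (nseq (s.+1 - k) (nth 0 lam 0) ++ lam))); last first.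
  by move: ltB => /=; lia.
rewrite big_mkcond; apply: eq_bigr => x _.
under [RHS]eq_bigl => k do rewrite inK_slack_fcons.
case: ltnP => [lt_x|] /=; last by rewrite big_pred0.
rewrite IH ?(path_sorted lam_sorted) //; last by move: ltB => /=; lia.
rewrite big_distrr; apply: eq_bigr => k _ /=.
rewrite [RHS]big_ord_recl fcons0 /=; congr (_ * _).
by apply: eq_bigr => i _; rewrite fconsS.
Qed.

(** * Monomials of [Omega] as dominated sequences *)

Lemma geq_trans : transitive geq.
Proof. exact: rev_trans leq_trans. Qed.

Lemma mem_domseqs c lam mu :
  (mu \in domseqs c lam) =
    [&& sorted geq mu, all (fun v => v < c) mu & all2 ltn mu lam].
Proof.
elim: lam c mu => [|l lam IH] c [|v mu] /=; rewrite ?mem_seq1 ?andbF //.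
  by apply/negP => /allpairsPdep[v [mu []]].
apply/allpairsPdep/idP => [[v' [mu' [lt_v in_mu [-> ->]]]]|].
  move: in_mu lt_v; rewrite IH mem_iota add0n leq_min /=.
  case/and3P=> mu'_sorted lt_mu' ->; case/andP=> lt_vc ->.
  rewrite (path_sortedE geq_trans) mu'_sorted lt_vc !andbT /=.
  by apply/andP; split; apply: sub_all lt_mu' => w /=; lia.
rewrite (path_sortedE geq_trans) => /and3P[/andP[le_mu mu_sorted]].
case/andP=> lt_vc _ /andP[lt_vl lt_mu]; exists v, mu; split=> //.
  by rewrite mem_iota add0n leq_min lt_vc.
by rewrite IH mu_sorted lt_mu !andbT.
Qed.

Lemma domseqs_uniq c lam : uniq (domseqs c lam).
Proof.
elim: lam c => [|l lam IH] c //=.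
apply: allpairs_uniq_dep => [|v _|]; rewrite ?iota_uniq //.
by move=> [v mu] [w nu] _ _ /= [-> ->].
Qed.

(** When [x] has to pass the head [y], we have [x < y < l' <= l]: then [y] fits under [l], and [x]
    still fits under [l']. *)
Lemma sorted_dominated_insert x l mu lam :
    sorted geq (l :: lam) -> sorted geq mu -> x < l -> all2 ltn mu lam ->
  exists2 nu, sorted geq nu & perm_eq nu (x :: mu) && all2 ltn nu (l :: lam).
Proof.
elim: mu lam x l => [|y mu IH] [|l' lam] x l //= lam_sorted mu_sorted lt_xl.
  by exists [:: x]; rewrite ?perm_refl //= lt_xl.
case/andP: lam_sorted => le_l'l lam_sorted /andP[lt_yl' lt_mu].
have [le_yx|lt_xy] := leqP y x.
  by exists [:: x, y & mu]; rewrite ?perm_refl /= ?le_yx // lt_xl lt_yl'.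
have [nu nu_sorted /andP[eq_nu lt_nu]] :=
  IH _ x l' lam_sorted (path_sorted mu_sorted) (ltn_trans lt_xy lt_yl') lt_mu.
exists (y :: nu) => /=.
  rewrite (path_sortedE geq_trans) nu_sorted andbT (perm_all _ eq_nu) /=.
  by move: mu_sorted; rewrite (path_sortedE geq_trans) (ltnW lt_xy) => /andP[].
rewrite (leq_trans lt_yl') // lt_nu !andbT; rewrite -(perm_cons y) in eq_nu.
by rewrite (permPl eq_nu); apply/seq.permP => p /=; rewrite addnCA.
Qed.

Lemma sorted_dominated mu lam : sorted geq lam -> all2 ltn mu lam ->
  exists2 nu, sorted geq nu & perm_eq nu mu && all2 ltn nu lam.
Proof.
elim: mu lam => [|x mu IH] [|l lam] //= lam_sorted; first by exists [::].
case/andP=> lt_xl /(IH _ (path_sorted lam_sorted))[nu nu_sorted].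
case/andP=> eq_nu lt_nu.
have [nu' nu'_sorted /andP[eq_nu' lt_nu']] :=
  sorted_dominated_insert lam_sorted nu_sorted lt_xl lt_nu.
exists nu' => //; rewrite lt_nu' andbT (permPl eq_nu').
by rewrite perm_cons.
Qed.

Definition mnm_of_seq m (t : seq nat) : 'X_{1..m} :=
  [multinom count_mem (j : nat) t | j < m].

Lemma mnm_of_seqE m t (j : 'I_m) : mnm_of_seq m t j = count_mem (j : nat) t.
Proof. exact: mnmE. Qed.

Section Support.
Local Open Scope ring_scope.
Import GRing.Theory Num.Theory.

(** Nonnegative coefficients cannot cancel. *)
Lemma msupp_sum_ge0 m (I : eqType) (r : seq I) (P : pred I)
    (F : I -> {mpoly int[m]}) a :
    (forall i b, P i -> 0 <= (F i)@_b) ->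
  (a \in msupp (\sum_(i <- r | P i) F i)) =
    has (fun i => P i && (a \in msupp (F i))) r.
Proof.
move=> F_ge0; rewrite mcoeff_msupp raddf_sum /=.
rewrite psumr_neq0 => [|i Pi]; last exact: F_ge0.
apply: eq_has => i; case Pi: (P i) => //=.
by rewrite mcoeff_msupp lt0r F_ge0 ?andbT.
Qed.

Lemma Omega_cons m l lam :
  Omega m (l :: lam) = \sum_(j < m | (j < l)%N) Omega m lam * 'X_j.
Proof. by rewrite /Omega big_cons mulrC big_distrr. Qed.

Lemma mcoeffMX_ge0 m (p : {mpoly int[m]}) (j : 'I_m) :
  (forall b, 0 <= p@_b) -> forall b, 0 <= (p * 'X_j)@_b.
Proof.
move=> p_ge0 b.
have [b_in|/memN_msupp_eq0 ->//] := boolP (b \in msupp (p * 'X_j)).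
move: b_in; rewrite (perm_mem (msuppMX _ _)) => /mapP[b' _ ->].
by rewrite mcoeffMX.
Qed.

Lemma mcoeff_Omega_ge0 m lam a : 0 <= (Omega m lam)@_a.
Proof.
elim: lam a => [|l lam IH] a; first by rewrite /Omega big_nil mcoeff1 ler0n.
rewrite Omega_cons raddf_sum /= sumr_ge0 // => j _.
exact: mcoeffMX_ge0.
Qed.

(** Expanding the product picks one variable from each factor; [l <= m] ensures that every index
    below [l] names a variable of the ring. *)
Lemma msupp_Omega m lam a : all (fun l => l <= m)%N lam ->
  a \in msupp (Omega m lam) <->
    (exists2 mu, all2 ltn mu lam & a = mnm_of_seq m mu).
Proof.
elim: lam a => [|l lam IH] a /=.
  rewrite /Omega big_nil msupp1 mem_seq1 => _; split=> [/eqP ->|].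
    by exists [::] => //; apply/mnmP => j; rewrite mnm_of_seqE mnm0E.
  by case=> -[|? ?] // _ ->; apply/eqP/mnmP => j; rewrite mnm_of_seqE.
case/andP=> le_lm le_lam; rewrite Omega_cons msupp_sum_ge0; last first.
  by move=> j b _; apply/mcoeffMX_ge0/mcoeff_Omega_ge0.
have mnm_cons (j : 'I_m) mu :
    mnm_of_seq m (nat_of_ord j :: mu) = (U_(j) + mnm_of_seq m mu)%MM.
  by apply/mnmP => i; rewrite mnmDE mnm1E !mnm_of_seqE /=.
split=> [/hasP[j _ /andP[lt_jl]]|[[|v mu] //= /andP[lt_vl lt_mu] ->]].
  rewrite (perm_mem (msuppMX _ _)) => /mapP[b /(IH b le_lam)[mu lt_mu ->] ->].
  by exists (nat_of_ord j :: mu); rewrite ?mnm_cons //= lt_jl.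
pose j := Ordinal (leq_trans lt_vl le_lm).
apply/hasP; exists j; rewrite ?mem_index_enum //= lt_vl /=.
rewrite (perm_mem (msuppMX _ _)) (mnm_cons j); apply: map_f.
by apply/(IH _ le_lam); exists mu.
Qed.

End Support.

Lemma mnm_of_seq_inj m mu nu :
    all (fun v => v < m) mu -> all (fun v => v < m) nu ->
  mnm_of_seq m mu = mnm_of_seq m nu -> perm_eq mu nu.
Proof.
move=> lt_mu lt_nu /mnmP eq_mn; apply/allP => v; rewrite mem_cat => v_in.
have lt_vm : v < m by case/orP: v_in; [apply/allP: v | apply/allP: v].
by have := eq_mn (Ordinal lt_vm); rewrite !mnm_of_seqE => /eqP.
Qed.

(** Both lists are duplicate-free: a weakly decreasing sequence is determined by its monomial, and
    any choice of variables can be sorted without losing domination. *)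
Lemma size_msupp_Omega m lam : sorted geq lam -> all (fun l => l <= m) lam ->
  size (msupp (Omega m lam)) = ndom m lam.
Proof.
move=> lam_sorted le_lam; rewrite /ndom -(size_map (mnm_of_seq m)).
have lt_all mu : all2 ltn mu lam -> all (fun v => v < m) mu.
  elim: lam mu le_lam {lam_sorted} => [|l lam IH] [|v mu] //=.
  case/andP=> le_l /IH le_lam /andP[lt_v /le_lam ->].
  by rewrite (leq_trans lt_v).
apply/perm_size/uniq_perm => [||a]; first exact: msupp_uniq.
  rewrite map_inj_in_uniq ?domseqs_uniq // => mu nu.
  rewrite !mem_domseqs => /and3P[mu_sorted lt_mu _] /and3P[nu_sorted lt_nu _].
  move/(mnm_of_seq_inj lt_mu lt_nu); apply: (sorted_eq geq_trans) => //.
  by move=> x y /=; rewrite andbC -eqn_leq => /eqP.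
apply/idP/mapP => [/(msupp_Omega _ le_lam)[mu lt_mu ->]|[mu]].
  have [nu nu_sorted /andP[eq_nu lt_nu]] := sorted_dominated lam_sorted lt_mu.
  exists nu; first by rewrite mem_domseqs nu_sorted lt_nu lt_all.
  by apply/mnmP => j; rewrite !mnm_of_seqE; apply/esym/seq.permP.
rewrite mem_domseqs => /and3P[_ _ lt_mu] ->.
by apply/(msupp_Omega _ le_lam); exists mu.
Qed.

(** * From [N] to the two formulas *)

(** Lets each count in (b) use whichever bound [ndom_incr] produces. *)
Lemma N_ndom c lam : sorted geq lam -> all (fun l => l <= c) lam ->
  N lam = ndom c lam.
Proof.
move=> lam_sorted le_c.
have le_max : all (fun l => l <= \max_(l <- lam) l) lam.
  by apply/allP => l l_in; apply: leq_bigmax_seq.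
rewrite /N size_msupp_Omega //; apply: eq_ndom; apply/eq_in_map => l l_in.
by rewrite (minn_idPr (allP le_max l l_in)) (minn_idPr (allP le_c l l_in)).
Qed.

Theorem lemma4p1 (n : nat) (lam : n.-tuple nat) (hlam : sorted geq lam) :
  N lam = \sum_(k in K n)
            \prod_(i < n) multichoose (nth 0 lam i - nth 0 lam i.+1) (k i)
  /\
  forall i : 'I_n, sorted geq (incr_nth lam i) ->
    N (incr_nth lam i) =
      N lam + N (rcons [seq l - nth 0 lam i | l <- take i lam] 1)
              * N (drop i.+1 lam).
Proof.
have all_head s : sorted geq s -> all (fun l => l <= nth 0 s 0) s.
  by case: s => //= l s; rewrite (path_sortedE geq_trans) leqnn => /andP[].
split.
  rewrite (N_ndom hlam (all_head _ hlam)).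
  have := @ndom_multichoose n.+1 0 lam hlam; rewrite size_tuple => -> //.
  by apply: eq_bigl => k; rewrite inE.
move=> i; have lt_i : i < size lam by rewrite size_tuple.
set x := nth 0 lam i; set lam1 := take i lam; set lam2 := drop i.+1 lam.
have lamE : tval lam = lam1 ++ x :: lam2.
  by rewrite -[LHS](cat_take_drop i) (drop_nth 0).
have -> : incr_nth lam i = lam1 ++ x.+1 :: lam2.
  have size_lam1 : size lam1 = i by rewrite size_takel // ltnW.
  rewrite lamE -{1}size_lam1; elim: (lam1) => //= l s IH. by rewrite IH.
move: (hlam); rewrite lamE => lam_sorted incr_sorted.
(* Since the raised list is still sorted, every earlier part is at least [x.+1]. *)
have lt_lam1 : all (fun l => x < l) lam1.
  apply/allP => l l_in; move: incr_sorted.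
  rewrite (sorted_pairwise geq_trans) pairwise_cat => /and3P[/allrelP lt1 _ _].
  by apply: lt1; rewrite ?mem_head.
have le_lam2 : all (fun l => l <= x) lam2.
  move: lam_sorted; rewrite (sorted_pairwise geq_trans) pairwise_cat.
  by case/and3P => _ _ /= /andP[].
have [lam1_sorted lam2_sorted] : sorted geq lam1 /\ sorted geq lam2.
  by rewrite take_sorted ?drop_sorted.
set c := nth 0 (lam1 ++ x.+1 :: lam2) 0.
have le_c := all_head _ incr_sorted.
(* The three remaining counts carry the bounds [c], [c - x] and [x.+1], each at least the parts of
   its list. *)
rewrite (N_ndom incr_sorted le_c) ndom_incr //; congr (_ + _ * _).
- apply/esym/N_ndom => //; move: le_c; rewrite -/c !all_cat /=.
  by case/and3P=> -> /ltnW -> ->.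
- apply/esym/N_ndom; last first.
    move: le_c; rewrite -/c all_cat all_rcons all_map /= => /and3P[le1 lt_xc _].
    by rewrite subn_gt0 lt_xc; apply: sub_all le1 => l /=; lia.
  rewrite (sorted_pairwise geq_trans) pairwise_rcons.
  rewrite -(sorted_pairwise geq_trans) all_map sorted_map; apply/andP; split.
    by apply: sub_all lt_lam1 => l /=; rewrite subn_gt0.
  by apply: sub_sorted lam1_sorted => l l' /=; lia.
- by apply/esym/N_ndom => //; apply: sub_all le_lam2 => l; lia.
Qed.
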